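(* Let $K\subseteq\mathbb{R}^n$ be nonempty, closed and convex, let $f=(f_1,\dots,f_m):K\to\mathbb{R}^m$ be continuous, and let $f_1,\dots,f_m$ be quasi-convex on $K$ and bounded from below by $0$ on $K$ (i.e. $f_i(x)\ge0$ for all $x\in K$ and all $i$). Assume that $\Theta_2$ has bounded values, i.e. $\Theta_2(\xi)$ is bounded for every $\xi\in\operatorname{dom}\Theta_2$. Then the weak Pareto solution set $\operatorname{Sol}^w(K,f)$ is unbounded if and only if $\operatorname{dom}\Theta_2$ is non-closed in $\Delta$.
   Context: $\Delta=\{(\xi_1,\dots,\xi_m)\in\mathbb{R}^m_+:\xi_1+\dots+\xi_m=1\}$. For $\xi\in\Delta$, $f^\xi(x)=\max\{\xi_1f_1(x),\dots,\xi_mf_m(x)\}$, and $\Theta_2(\xi)$ is the set of global minimizers of $f^\xi$ over $K$. $\operatorname{dom}\Theta_2=\{\xi\in\Delta:\Theta_2(\xi)\neq\emptyset\}$. A point $x\in K$ is a weak Pareto solution (an element of $\operatorname{Sol}^w(K,f)$) if there is no $y\in K$ with $f(y)-f(x)\in-\operatorname{int}\mathbb{R}^m_+$. A function $g:K\to\mathbb{R}$ is quasi-convex on $K$ if $g(tx+(1-t)y)\le\max\{g(x),g(y)\}$ for all $x\neq y$ in $K$ and $t\in(0,1)$. *)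

(* Defs.v *)
From HB Require Import structures.
From mathcomp Require Import all_boot all_order all_algebra.
From mathcomp Require Import all_classical all_reals all_analysis.

Set Implicit Arguments.
Unset Strict Implicit.
Unset Printing Implicit Defensive.

Import Order.TTheory GRing.Theory Num.Theory.
Import numFieldNormedType.Exports.

Local Open Scope classical_set_scope.
Local Open Scope ring_scope.

(* Points of R^n are row vectors. The number of objectives is written m.+1, so
   that it is at least one. A function on K is a total function whose values
   outside K are never used. *)

Definition orthant (R : realType) (m : nat) : set 'rV[R]_m :=
  [set v | forall i, 0 <= v 0 i].

Definition Delta (R : realType) (m : nat) : set 'rV[R]_m :=
  [set xi | orthant xi /\ \sum_(i < m) xi 0 i = 1].

(* The default value of the big operator is the first term, so this is the
   genuine maximum of the m.+1 terms, whatever their signs. *)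
Definition fmax (R : realType) (n m : nat) (f : 'rV[R]_n -> 'rV[R]_m.+1)
    (xi : 'rV[R]_m.+1) (x : 'rV[R]_n) : R :=
  \big[Num.max/xi 0 ord0 * f x 0 ord0]_(i < m.+1) (xi 0 i * f x 0 i).

Definition Theta2 (R : realType) (n m : nat) (K : set 'rV[R]_n)
    (f : 'rV[R]_n -> 'rV[R]_m.+1) (xi : 'rV[R]_m.+1) : set 'rV[R]_n :=
  [set x | K x /\ forall y, K y -> fmax f xi x <= fmax f xi y].

Definition dom_Theta2 (R : realType) (n m : nat) (K : set 'rV[R]_n)
    (f : 'rV[R]_n -> 'rV[R]_m.+1) : set 'rV[R]_m.+1 :=
  [set xi | Delta xi /\ Theta2 K f xi !=set0].

Definition weak_pareto (R : realType) (n m : nat) (K : set 'rV[R]_n)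
    (f : 'rV[R]_n -> 'rV[R]_m) : set 'rV[R]_n :=
  [set x | K x /\
    ~ exists y, K y /\ ((fun v => - v) @` (@orthant R m)°) (f y - f x)].

Definition quasi_convex_on (R : realType) (n : nat) (K : set 'rV[R]_n)
    (g : 'rV[R]_n -> R) : Prop :=
  forall x y : 'rV[R]_n, K x -> K y -> x <> y ->
  forall t : R, 0 < t -> t < 1 ->
    g (t *: x + (1 - t) *: y) <= Num.max (g x) (g y).

(* Main.v *)
Require Import Defs.
From HB Require Import structures.
From mathcomp Require Import all_boot all_order all_algebra.
From mathcomp Require Import all_classical all_reals all_analysis.
Import Order.TTheory GRing.Theory Num.Theory.
Import numFieldNormedType.Exports.
Local Open Scope classical_set_scope.
Local Open Scope ring_scope.
Set Implicit Arguments.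
Unset Strict Implicit.

(** Write [f^xi] for [fmax f xi], and call the points of [Theta2 K f xi] the
    [xi]-minimizers. The proof rests on two facts.

    The weak Pareto set is the union of all [Theta2 K f xi] with [xi] in the
    simplex ([weak_paretoE]). This is where [f >= 0] matters: a weak Pareto
    point [x] with all [f_i x > 0] minimizes [f^xi] for the weights
    proportional to [1 / f_i x], which make all [xi_i * f_i x] equal; and if
    some [f_i x = 0], then [x] minimizes [f_i] itself, which is [f^xi] for the
    [i]-th vertex of the simplex.

    Failing to be a minimizer is an open condition, uniformly on compact sets
    ([near_no_minimizer]): if every point of a compact [S] is beaten, for the
    value [f^xi], by some point of [Y], then the same holds for all weights
    close to [xi].

    If the union is bounded, it lies in a compact part [S] of [K]. When [xi]
    has no minimizer, every point of [S] is beaten by a point of [K], so nearby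
    weights have no minimizer in [S], hence none at all: the domain is closed
    ([dom_Theta2_closed]).

    Conversely, let the domain be closed. Each [xi] in the simplex has a
    neighbourhood on which the minimizers stay in a fixed ball. Off the domain
    this holds since a whole neighbourhood has no minimizer. On the domain, take
    a minimizer [x0] and a sphere [S] around it that encloses the bounded set
    [Theta2 K f xi]: [x0] beats every point of [S] for [xi], hence for nearby
    weights, and quasi-convexity along the segment from [x0] then prevents
    minimizers beyond [S] ([Theta2_locally_bounded]). Compactness of the simplex
    turns these local bounds into a global one ([Theta2_bounded_bigcup]). *)

(** * Weak Pareto points, convexity and the simplex *)

Lemma interior_orthantP (R : realType) (m : nat) (v : 'rV[R]_m) :
  ((@orthant R m)° v) <-> (forall i, 0 < v 0 i).
Proof.
split=> [/nbhs_ballP[e /= e0 ball_e] i|v_gt0].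
  have /ball_e /(_ i) : ball v e (v - const_mx (e / 2)).
    split=> // k j; rewrite -ball_normE /= !mxE opprB addrCA subrr addr0.
    by rewrite gtr0_norm ?divr_gt0// ltr_pdivrMr// ltr_pMr// ltr1n.
  by rewrite !mxE subr_ge0; apply: lt_le_trans; rewrite divr_gt0.
have : nbhs v [set w : 'rV[R]_m | forall i, 0 < w 0 i].
  pose P i (w : 'rV[R]_m) := 0 < w 0 i.
  apply: (@filter_forall _ _ P (nbhs v)) => i.
  exact: (cvgr_gt (v 0 i) (@coord_continuous _ _ _ 0 i v)).
by apply: filterS => w w_gt0 i; exact: ltW.
Qed.

Lemma weak_paretoP (R : realType) (n m : nat) (K : set 'rV[R]_n)
    (f : 'rV[R]_n -> 'rV[R]_m) (x : 'rV[R]_n) :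
  weak_pareto K f x <->
  K x /\ forall y, K y -> exists i, f x 0 i <= f y 0 i.
Proof.
split=> -[Kx Px]; split=> //.
  move=> y Ky; apply: contrapT => /forallNP lt_yx; apply: Px.
  exists y; split=> //; exists (f x - f y); last by rewrite opprB.
  apply/interior_orthantP => i; rewrite !mxE subr_gt0 ltNge.
  exact/negP/lt_yx.
move=> [y [Ky [v /interior_orthantP v_gt0 vE]]].
have [i le_xy] := Px _ Ky; have := v_gt0 i.
have -> : v = f x - f y by rewrite -(opprB (f y)) -vE opprK.
by rewrite !mxE subr_gt0 ltNge le_xy.
Qed.

Lemma convex_set_segment (R : numDomainType) (V : lmodType R) (K : set V)
    (x y : V) (t : R) :
  convex_set K -> K x -> K y -> 0 <= t -> t <= 1 -> K (t *: x + (1 - t) *: y).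
Proof.
move=> K_convex Kx Ky t_ge0 t_le1.
have t01 : Itv.spec (@Itv.num_sem R) (Itv.Real `[0%Z, 1%Z]) t.
  by rewrite /= /Itv.num_sem /= in_itv /= t_ge0 t_le1 ger0_real.
have := K_convex x y (Itv.mk t01); rewrite !inE; exact.
Qed.

Lemma Delta_closed (R : realType) (m : nat) : closed (@Delta R m).
Proof.
have -> : @Delta R m =
    \bigcap_i [set xi : 'rV[R]_m | 0 <= xi 0 i] `&`
    [set xi : 'rV[R]_m | \sum_(i < m) xi 0 i = 1].
  apply/seteqP; split=> xi [xi_ge0 xi_sum]; split=> // i; last exact: xi_ge0.
  by move=> _; exact: xi_ge0.
apply: closedI.
  apply: closed_bigI => i _.
  apply: (@preimage_closed _ _ (fun xi : 'rV[R]_m => xi 0 i) [set y | 0 <= y]).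
    by move=> xi _; exact: coord_continuous.
  exact: closed_ge.
apply: (@preimage_closed _ _
  (fun xi : 'rV[R]_m => \sum_(i < m) xi 0 i) [set 1]).
  move=> xi _; apply: (@cvg_big _ _ +%R _ xpredT _ _ (nbhs xi)) => [|i _].
    exact: add_continuous.
  exact: coord_continuous.
exact: closed_eq.
Qed.

Lemma Delta_compact (R : realType) (m : nat) : compact (@Delta R m).
Proof.
have cube_compact :
    compact [set xi : 'rV[R]_m | forall i, xi ord0 i \in `[(0 : R), 1]].
  by apply: (@rV_compact _ _ (fun=> `[(0 : R), 1]%classic)) => _;
    exact: segment_compact.
apply: subclosed_compact (@Delta_closed R m) cube_compact _.
move=> xi [xi_ge0 xi_sum] i; rewrite /= in_itv/= xi_ge0/= -xi_sum.
by rewrite (bigD1 i)//= lerDl sumr_ge0// => j _; exact: xi_ge0.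
Qed.

(** * The weighted maximum *)

Section Scalarization.
Variables (R : realType) (n m : nat) (K : set 'rV[R]_n).
Variable f : 'rV[R]_n -> 'rV[R]_m.+1.
Implicit Types (xi : 'rV[R]_m.+1) (x y z : 'rV[R]_n).

Lemma le_fmax xi x i : xi 0 i * f x 0 i <= fmax f xi x.
Proof. exact: le_bigmax. Qed.

Lemma fmax_leP xi x c :
  fmax f xi x <= c <-> (forall i, xi 0 i * f x 0 i <= c).
Proof.
split=> [le_c i|le_c]; first exact: le_trans (le_fmax _ _ _) le_c.
by apply: bigmax_le.
Qed.

Lemma fmax_lt xi x c :
  (forall i, xi 0 i * f x 0 i < c) -> fmax f xi x < c.
Proof. by move=> lt_c; exact: bigmax_lt. Qed.

(** Since the maximum on the right is attained, a strict inequality between two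
    weighted maxima amounts to finitely many strict inequalities between
    products, each of which is stable under small perturbations. *)
Lemma fmax_lt2P xi x y :
  fmax f xi x < fmax f xi y <->
  exists i, forall j, xi 0 j * f x 0 j < xi 0 i * f y 0 i.
Proof.
split=> [lt_xy|[i lt_i]]; last first.
  by apply: lt_le_trans (le_fmax xi y i); apply: bigmax_lt.
apply: contrapT => /forallNP no_i; move: lt_xy; rewrite ltNge => /negP; apply.
apply/fmax_leP => i; have /existsNP[j /negP] := no_i i.
by rewrite -leNgt => /le_trans; apply; exact: le_fmax.
Qed.

Hypothesis f_continuous : {within K, continuous f}.

(** The weights and the beaten point [z] vary jointly, while [y] stays fixed:
    the covering argument over a compact set of points [z] needs the joint
    perturbation. *)
Lemma near_fmax_lt xi y z : K z -> fmax f xi y < fmax f xi z ->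
  \forall z' \near z & xi' \near xi, K z' -> fmax f xi' y < fmax f xi' z'.
Proof.
move=> Kz /fmax_lt2P[i lt_i].
have f_cvg : f w @[w --> within K (nbhs z)] --> f z.
  by have /subspace_continuousP := f_continuous; apply.
pose F : set_system ('rV[R]_n * 'rV[R]_m.+1) :=
  filter_prod (within K (nbhs z)) (nbhs xi).
pose gap j (p : 'rV[R]_n * 'rV[R]_m.+1) :=
  p.2 0 i * f p.1 0 i - p.2 0 j * f y 0 j.
have : F [set p | forall j, 0 < gap j p].
  apply: (@filter_forall _ _ (fun j p => 0 < gap j p) F) => j.
  have x_cvg k : (fun p => (p.2 : 'rV[R]_m.+1) 0 k) @ F --> xi 0 k.
    have snd_cvg : snd @ F --> xi by exact: cvg_snd.
    exact: (@cvg_comp _ _ _ snd (fun v : 'rV[R]_m.+1 => v 0 k) _ _ _ snd_cvg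
      (@coord_continuous _ _ _ 0 k xi)).
  have fz_cvg : (fun p => f p.1 0 i) @ F --> f z 0 i.
    have fst_cvg : fst @ F --> within K (nbhs z) by exact: cvg_fst.
    exact: (@cvg_comp _ _ _ (f \o fst) (fun v : 'rV[R]_m.+1 => v 0 i) _ _ _
      (cvg_comp _ _ fst_cvg f_cvg) (@coord_continuous _ _ _ 0 i (f z))).
  have gap_cvg : gap j @ F --> xi 0 i * f z 0 i - xi 0 j * f y 0 j.
    by apply: cvgB; apply: cvgM => //; exact: cvg_cst.
  by apply: (cvgr_gt _ gap_cvg); rewrite subr_gt0.
move=> [[A B] /= [A_near B_near] sub_AB].
exists ((fun w => K w -> A w), B) => //= -[w xi'] /= [Aw Bxi'] Kw.
apply/fmax_lt2P; exists i => j; rewrite -subr_gt0.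
by apply: (sub_AB (w, xi')); split=> //; exact: Aw.
Qed.

(** Compactness of [S] makes the neighbourhoods given by [near_fmax_lt] uniform
    over the beaten points. The set [Y] of competitors is a parameter because
    the two directions of the theorem need [Y = K] and [Y] a singleton. *)
Lemma near_no_minimizer xi (S Y : set 'rV[R]_n) :
    compact S -> S `<=` K ->
    (forall z, S z -> exists2 y, Y y & fmax f xi y < fmax f xi z) ->
  \forall xi' \near xi,
    S `<=` [set z | exists2 y, Y y & fmax f xi' y < fmax f xi' z].
Proof.
move=> /compact_near_coveringP S_cover SK lt_S.
pose P xi' z := S z -> exists2 y, Y y & fmax f xi' y < fmax f xi' z.
have : \forall xi' \near xi, S `<=` P xi'.
  apply: (S_cover _ (nbhs xi) P) => z Sz; have [y Yy lt_yz] := lt_S z Sz.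
  have := near_fmax_lt (SK z Sz) lt_yz; apply: filterS => -[z' xi'] /= lt_near.
  by move=> /SK Kz'; exists y => //; exact: lt_near.
by apply: filterS => xi' SP z Sz; exact: SP.
Qed.

(** * Bounded solution sets have a closed domain *)

Hypothesis K_closed : closed K.

Lemma dom_Theta2_closed :
  bounded_set (\bigcup_(xi in @Delta R m.+1) Theta2 K f xi) ->
  closed (dom_Theta2 K f).
Proof.
move=> [M [_ Theta2_le]]; set r := M + 1.
have {}Theta2_le xi x : Delta xi -> Theta2 K f xi x -> `|x| <= r.
  by move=> Dxi xiPx; apply: (Theta2_le r); [rewrite ltrDl|exists xi].
pose S := K `&` [set x | `|x| <= r].
have S_compact : compact S.
  apply: bounded_closed_compact.
    exists r; split; rewrite ?num_real// => s /ltW r_le x [_ /le_trans].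
    exact.
  apply: closedI => //; apply: (@preimage_closed _ _ _ [set y : R | y <= r]).
    by move=> x _; exact: norm_continuous.
  exact: closed_le.
have S_near xi := @near_no_minimizer xi S K S_compact (fun _ => @proj1 _ _).
rewrite -openC openE => xi xi_notdom.
have [Dxi|nDxi] := pselect (Delta xi); last first.
  have /closed_openC := @Delta_closed R m.+1; rewrite openE => /(_ xi nDxi).
  by apply: filterS => xi' nDxi' [].
have : \forall xi' \near xi,
    S `<=` [set z | exists2 y, K y & fmax f xi' y < fmax f xi' z].
  apply: S_near => z [Kz _]; apply: contrapT => no_y; apply: xi_notdom.
  split=> //; exists z; split=> // y Ky; rewrite leNgt; apply/negP => lt_yz.
  by apply: no_y; exists y.
apply: filterS => xi' S_lt [Dxi' [x xi'Px]].
have [|y Ky] := S_lt x; first by split; [case: xi'Px|exact: Theta2_le xi'Px].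
by rewrite ltNge xi'Px.2.
Qed.

(** * A closed domain has a bounded solution set *)

Hypothesis K_convex : convex_set K.
Hypothesis f_quasi_convex : forall i, quasi_convex_on K (fun x => f x 0 i).

Lemma fmax_quasi_convex xi : orthant xi -> quasi_convex_on K (fmax f xi).
Proof.
move=> xi_ge0 x y Kx Ky xy t t0 t1; apply/fmax_leP => i.
have /(ler_wpM2l (xi_ge0 i)) /le_trans := f_quasi_convex i Kx Ky xy t0 t1.
apply; rewrite maxr_pMr//; apply: le_max2; exact: le_fmax.
Qed.

(** Take a minimizer [x0] for [xi] and a radius [rho] such that all minimizers
    for [xi] are within [rho] of [x0]. On the sphere of radius [rho], [x0] is
    strictly better for [xi], hence for nearby weights. A minimizer [x] for such
    weights outside the sphere would give, where the segment from [x0] to [x]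
    crosses it, a value at most that at [x0], by quasi-convexity: a
    contradiction. *)
Lemma Theta2_locally_bounded xi :
    Theta2 K f xi !=set0 -> bounded_set (Theta2 K f xi) ->
  exists r, \forall xi' \near xi,
    orthant xi' -> Theta2 K f xi' `<=` [set x | `|x| <= r].
Proof.
move=> [x0 [Kx0 x0_min]] [M [_ Theta2_le]].
(* |M| + 1 exceeds M, so it bounds the norms of the xi-minimizers; the further
   1 keeps them strictly inside the sphere of radius rho. *)
set rho := `|M| + 2 + `|x0|.
have rho_gt0 : 0 < rho by rewrite ltr_wpDr// ltr_wpDl.
have Theta2_lt x : Theta2 K f xi x -> `|x - x0| < rho.
  move=> xiPx; apply: le_lt_trans (ler_normB _ _) _; rewrite ltrD2r.
  apply: (@le_lt_trans _ _ (`|M| + 1)); last by rewrite ltrD2l ltr1n.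
  by apply: (Theta2_le (`|M| + 1)) => //; rewrite ltr_pwDr// ler_norm.
pose S := K `&` [set x | `|x - x0| = rho].
have S_compact : compact S.
  apply: bounded_closed_compact.
    exists (rho + `|x0|); split; rewrite ?num_real// => s /ltW le_s x [_ xE] /=.
    apply: le_trans le_s; rewrite -xE -[in leLHS](subrK x0 x).
    exact: ler_normD.
  apply: closedI => //.
  apply: (@preimage_closed _ _ (fun x => `|x - x0|) [set rho]).
    move=> x _; have sub_cvg : (fun x => x - x0) @ x --> x - x0.
      by apply: (@cvgB _ _ _ (nbhs x)) => /=; [exact: cvg_id|exact: cvg_cst].
    exact: cvg_norm sub_cvg.
  exact: closed_eq.
exists (rho + `|x0|).
have : \forall xi' \near xi,
    S `<=` [set z | exists2 y, [set x0] y & fmax f xi' y < fmax f xi' z].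
  apply: near_no_minimizer S_compact (fun _ => @proj1 _ _) _ => z [Kz zE].
  exists x0 => //.
  rewrite ltNge; apply/negP => le_z.
  suff /Theta2_lt : Theta2 K f xi z by rewrite zE ltxx.
  by split=> // y Ky; apply: le_trans le_z _; exact: x0_min.
apply: filterS => xi' S_lt xi'_ge0 x [Kx x_min] /=.
suff : `|x - x0| <= rho.
  move=> le_rho; rewrite -[in leLHS](subrK x0 x).
  by apply: le_trans (ler_normD _ _) _; rewrite lerD2r.
rewrite leNgt; apply/negP => lt_rho.
have norm_gt0 : 0 < `|x - x0| by exact: lt_trans lt_rho.
(* The segment from x0 to x crosses the sphere at the parameter t. *)
set t := rho / `|x - x0|.
have t0 : 0 < t by rewrite divr_gt0.
have t1 : t < 1 by rewrite ltr_pdivrMr// mul1r.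
have xx0 : x <> x0 by move=> xE; move: norm_gt0; rewrite xE subrr normr0 ltxx.
set z := t *: x + (1 - t) *: x0.
have zE : z - x0 = t *: (x - x0).
  by rewrite /z scalerBl scale1r scalerBr -addrA addrAC subrr sub0r.
have [|_ -> ] := S_lt z.
  split; first exact: convex_set_segment K_convex Kx Kx0 (ltW t0) (ltW t1).
  by rewrite /= zE normrZ gtr0_norm// divfK// gt_eqF.
rewrite ltNge => /negP; apply.
have := fmax_quasi_convex xi'_ge0 Kx Kx0 xx0 t0 t1.
by rewrite (max_idPr (x_min _ Kx0)).
Qed.

(** Every point of the simplex has a neighbourhood with a common bound on the
    minimizers, obtained from [Theta2_locally_bounded] on the domain and
    vacuous off it; finitely many such neighbourhoods cover the simplex. *)
Lemma Theta2_bounded_bigcup :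
    closed (dom_Theta2 K f) ->
    (forall xi, dom_Theta2 K f xi -> bounded_set (Theta2 K f xi)) ->
  bounded_set (\bigcup_(xi in @Delta R m.+1) Theta2 K f xi).
Proof.
move=> dom_closed Theta2_bnd.
pose P (r : R) xi := Delta xi -> Theta2 K f xi `<=` [set x | `|x| <= r].
have : \forall r \near +oo, @Delta R m.+1 `<=` P r.
  have /compact_near_coveringP := @Delta_compact R m.+1; apply=> xi Dxi.
  have [xi_dom|xi_notdom] := pselect (dom_Theta2 K f xi).
    have [r Theta2_r] :=
      Theta2_locally_bounded xi_dom.2 (Theta2_bnd _ xi_dom).
    exists ([set xi' | orthant xi' -> Theta2 K f xi' `<=` [set x | `|x| <= r]],
      [set s | r <= s]) => /=.
      by split=> //; apply: nbhs_pinfty_ge; rewrite ?num_real.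
    case=> xi' s /= -[le_r le_rs] [xi'_ge0 _] x xi'Px /=.
    exact: le_trans (le_r xi'_ge0 x xi'Px) le_rs.
  exists (~` dom_Theta2 K f, setT) => /=.
    split; last exact: filterT.
    by have /closed_openC := dom_closed; rewrite openE; exact.
  move=> [xi' s] /= [xi'_notdom _] Dxi' x xi'Px; exfalso.
  by apply: xi'_notdom; split=> //; exists x.
apply: filterS => r Delta_r x [xi Dxi xiPx].
exact: Delta_r xiPx.
Qed.

(** * The weak Pareto set as a union of sets of minimizers *)

Hypothesis f_ge0 : forall i x, K x -> 0 <= f x 0 i.

(** A weak Pareto point [x] becomes a minimizer for weights that equalize the
    [f_i x], or for a vertex of the simplex when some [f_i x] is zero. In the
    other direction, improving all [f_i] strictly at [x] improves [f^xi]
    strictly: the terms of positive weight decrease, and those of zero weight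
    lie below [f^xi] at [x], which is positive because some weight is and
    because every [f_i x] exceeds a value of the nonnegative [f_i]. *)
Lemma weak_paretoE :
  weak_pareto K f = \bigcup_(xi in @Delta R m.+1) Theta2 K f xi.
Proof.
apply/seteqP; split=> x.
  move=> /weak_paretoP[Kx x_pareto].
  have [[i fi_le0]|/forallNP f_nle0] := pselect (exists i, f x 0 i <= 0).
    have xiE j : (delta_mx 0 i : 'rV[R]_m.+1) 0 j = (j == i)%:R.
      by rewrite mxE eqxx.
    (* f_i x = 0 is the least possible value of f_i: use the i-th vertex. *)
    exists (delta_mx 0 i).
      split=> [j|]; first by rewrite xiE.
      rewrite (bigD1 i)//= xiE eqxx big1 ?addr0// => j /negbTE ji.
      by rewrite xiE ji.
    split=> // y Ky; apply/fmax_leP => j; apply: le_trans (le_fmax _ _ i).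
    rewrite !xiE eqxx mul1r; apply: le_trans (f_ge0 i Ky).
    by case: eqP => [->|_]; rewrite ?mul1r ?mul0r.
  have f_gt0 i : 0 < f x 0 i by rewrite ltNge; exact/negP/f_nle0.
  set s := \sum_(i < m.+1) (f x 0 i)^-1.
  have s_gt0 : 0 < s.
    rewrite /s (bigD1 ord0)//= ltr_wpDr ?invr_gt0//.
    by apply: sumr_ge0 => i _; rewrite invr_ge0 ltW.
  (* These weights make all the products xi_i * f_i x equal. *)
  pose xi : 'rV[R]_m.+1 := \row_i ((f x 0 i)^-1 / s).
  have xi_gt0 i : 0 < xi 0 i by rewrite mxE divr_gt0 ?invr_gt0.
  exists xi.
    split=> [i|]; first exact: ltW.
    under eq_bigr do rewrite mxE.
    by rewrite -mulr_suml divff// gt_eqF.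
  split=> // y /x_pareto[i le_xy]; apply/fmax_leP => j.
  apply: le_trans (le_fmax _ _ i).
  have -> : xi 0 j * f x 0 j = xi 0 i * f x 0 i.
    by rewrite !mxE ![_^-1 / s]mulrC !mulfVK// gt_eqF.
  by rewrite ler_pM2l.
move=> [xi [xi_ge0 xi_sum] [Kx x_min]]; apply/weak_paretoP; split=> // y Ky.
apply: contrapT => /forallNP lt_yx.
have {}lt_yx i : f y 0 i < f x 0 i by rewrite ltNge; exact/negP/lt_yx.
have /existsNP[k /negP] : ~ forall k, xi 0 k <= 0.
  move=> xi_le0; have := @ltr01 R; rewrite -xi_sum ltNge.
  by rewrite sumr_le0.
rewrite -ltNge => xik_gt0.
have := x_min _ Ky; rewrite leNgt => /negP; apply; apply/fmax_lt => j.
have [xij0|xij_neq0] := eqVneq (xi 0 j) 0.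
  rewrite xij0 mul0r; apply: lt_le_trans (le_fmax _ _ k).
  by rewrite mulr_gt0//; apply: le_lt_trans (lt_yx k); exact: f_ge0.
apply: lt_le_trans (le_fmax _ _ j).
by rewrite ltr_pM2l// lt_neqAle eq_sym xij_neq0 xi_ge0.
Qed.

End Scalarization.

(** * Unboundedness against non-closedness *)

Theorem theorem6p2 (R : realType) (n m : nat) (K : set 'rV[R]_n)
    (f : 'rV[R]_n -> 'rV[R]_m.+1)
    (K_nonempty : K !=set0)
    (K_closed : closed K)
    (K_convex : convex_set K)
    (f_continuous : {within K, continuous f})
    (f_quasi_convex : forall i : 'I_m.+1,
       quasi_convex_on K (fun x => f x 0 i))
    (f_ge0 : forall (i : 'I_m.+1) (x : 'rV[R]_n), K x -> 0 <= f x 0 i)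
    (Theta2_bounded : forall xi : 'rV[R]_m.+1,
       dom_Theta2 K f xi -> bounded_set (Theta2 K f xi)) :
  ~ bounded_set (weak_pareto K f) <->
  ~ closed (dom_Theta2 K f : set (subspace (@Delta R m.+1))).
Proof.
have dom_sub : dom_Theta2 K f `<=` @Delta R m.+1 by move=> xi [].
have dom_closedE : closed (dom_Theta2 K f : set (subspace (@Delta R m.+1))) =
    closed (dom_Theta2 K f).
  rewrite -(closed_setIS (dom_Theta2 K f) (@Delta_closed R m.+1)).
  by rewrite (setIidl dom_sub).
rewrite (weak_paretoE f_ge0) dom_closedE.
split; apply: contra_not.
  by move=> ?; exact: Theta2_bounded_bigcup.
exact: dom_Theta2_closed.
Qed.
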